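(* Let $k=(k(n))_{n\ge 0}$ be a real sequence with $\sum_{n=0}^\infty |k(n)|<\infty$, and suppose that the solution $r$ of the resolvent equation $r(n+1)=\sum_{j=0}^{n}k(n-j)r(j)$, $n\ge 0$, $r(0)=1$, satisfies $\sum_{n=0}^\infty |r(n)|<\infty$. Let $f:\mathbb{R}\to\mathbb{R}$ be continuous with $\lim_{x\to\infty}f(x)/x=1$ and $\lim_{x\to-\infty}f(x)/x=1$. Let $H=(H(n))_{n\ge 0}$ be a real sequence, $\xi\in\mathbb{R}$, and let $x$ and $y$ be the solutions of $$x(n+1)=H(n+1)+\sum_{j=0}^{n}k(n-j)f(x(j)),\quad n\ge 0;\qquad x(0)=\xi,$$ $$y(n+1)=H(n+1)+\sum_{j=0}^{n}k(n-j)y(j),\quad n\ge 0;\qquad y(0)=\xi.$$ If $(a(n))_{n\ge 0}$ is an increasing real sequence with $a(n)\to\infty$ as $n\to\infty$ such that $$\limsup_{n\to\infty}\frac{|H(n)|}{a(n)}<+\infty,$$ then $$\limsup_{n\to\infty}\frac{|y(n)|}{a(n)}<+\infty\quad\text{and}\quad\lim_{n\to\infty}\frac{x(n)-y(n)}{a(n)}=0.$$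
   Context: The value $H(0)$ does not enter the equations for $x$ and $y$. *)

(* Defs.v *)
From Stdlib Require Import Reals.
From Coquelicot Require Import Coquelicot.

(* Main.v *)
Require Import Defs.
From Corelib Require Import ssreflect.
From Stdlib Require Import Reals Lra Lia Wf_nat.
From Coquelicot Require Import Coquelicot.
Open Scope R_scope.

(** Write [f t = t + phi t].  The asymptotics of [f] at both infinities, with
    continuity in between, say that [phi] is sublinear: for every [eps > 0]
    there is [C] with [|phi t| <= eps * |t| + C] for all [t]
    ([sublinear_perturbation]).

    Both equations are then linear convolution equations with the same kernel
    [k], and such equations are solved by convolving the forcing term with the
    resolvent [r] ([variation_of_constants]).  As [r] is summable, this
    convolution maps sequences bounded by a multiple of a nondecreasing
    sequence to sequences of the same kind ([conv_bound]).  Applied to [y],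
    this gives [y = O(a)].

    The difference [d = x - y] starts at [0] and solves the same equation with
    forcing [k * phi(x)], so [|d n|] is at most a constant times the maximum of
    [|phi (x j)|] over [j < n].  Since [x = d + y], sublinearity bounds this by
    [eps * max |d j| + eps * O(a n) + C]; for small [eps] the first term is
    absorbed by strong induction on [n] ([perturbation_gain]), leaving
    [|d n| <= eps' * a n + C'] with [eps'] arbitrary.  Dividing by
    [a n -> +oo] finishes the proof.

    Since [a] may be negative or zero at first, the global estimates use the
    weight [max 1 (a n)], which agrees with [a n] for large [n]. *)

(** * Convolution and the resolvent *)

Definition conv (u v : nat -> R) (n : nat) : R :=
  sum_n (fun j : nat => u (n - j)%nat * v j) n.

Lemma sum_n_triangle (F : nat -> nat -> R) (n : nat) :
  sum_n (fun m => sum_n (F m) m) n =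
  sum_n (fun j => sum_n (fun i => F (j + i)%nat j) (n - j)) n.
Proof.
induction n as [|n IH].
- now rewrite !sum_O.
- rewrite sum_Sn IH (sum_Sn (F (S n))) [RHS]sum_Sn Nat.sub_diag sum_O.
  rewrite Nat.add_0_r plus_assoc -sum_n_plus.
  f_equal; apply sum_n_ext_loc; intros j Hj.
  replace (S n - j)%nat with (S (n - j)) by lia.
  rewrite sum_Sn; do 2 f_equal; lia.
Qed.

Lemma conv_assoc (u v w : nat -> R) (n : nat) :
  conv u (conv v w) n = conv (conv u v) w n.
Proof.
unfold conv.
rewrite (sum_n_ext _ (fun m => sum_n
  (fun j => u (n - m)%nat * (v (m - j)%nat * w j)) m)).
2:{ intros m; symmetry; apply (sum_n_mult_l (K := R_Ring)). }
rewrite sum_n_triangle.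
apply sum_n_ext; intros j.
symmetry; etransitivity.
{ symmetry; apply (sum_n_mult_r (K := R_Ring)). }
apply sum_n_ext; intros i; simpl.
replace (n - (j + i))%nat with (n - j - i)%nat by lia.
replace (j + i - j)%nat with i by lia.
apply Rmult_assoc.
Qed.

(** Convolving the defining equation of [r] with [h] and using associativity
    shows that [conv r h] solves the equation; solutions are unique because
    each value is determined by the previous ones. *)
Lemma variation_of_constants (k r h z : nat -> R)
  (r0 : r 0%nat = 1) (rS : forall n, r (S n) = conv k r n)
  (z0 : z 0%nat = h 0%nat) (zS : forall n, z (S n) = h (S n) + conv k z n) :
  forall n, z n = conv r h n.
Proof.
induction n as [n IH] using lt_wf_ind.
destruct n as [|n].
- unfold conv; rewrite sum_O z0 r0; simpl; ring.
- rewrite zS {2}/conv sum_Sn Nat.sub_diag r0.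
  replace (conv k z n) with (conv k (conv r h) n).
  2:{ unfold conv at 1 3; apply sum_n_ext_loc; intros j Hj.
      rewrite IH; [reflexivity | lia]. }
  rewrite conv_assoc.
  replace (sum_n (fun j => r (S n - j)%nat * h j) n) with (conv (conv k r) h n).
  2:{ unfold conv at 1; apply sum_n_ext_loc; intros j Hj.
      now replace (S n - j)%nat with (S (n - j)) by lia; rewrite rS. }
  unfold plus; simpl; ring.
Qed.

Lemma sum_n_rev (u : nat -> R) (n : nat) :
  sum_n (fun j => u (n - j)%nat) n = sum_n u n.
Proof.
induction n as [|n IH].
- now rewrite !sum_O.
- rewrite [RHS]sum_Sn -IH /sum_n sum_Sn_m; [|lia].
  rewrite -sum_n_m_S Nat.sub_0_r; apply plus_comm.
Qed.

Lemma sum_n_le_Series (u : nat -> R) (n : nat) :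
  (forall j, 0 <= u j) -> ex_series u -> sum_n u n <= Series u.
Proof.
intros u0 su.
apply (is_lim_seq_incr_compare (sum_n u)).
- exact (Series_correct _ su).
- intros m; rewrite sum_Sn; generalize (u0 (S m)); unfold plus; simpl; lra.
Qed.

Lemma Series_Rabs_ge0 (u : nat -> R) :
  ex_series (fun n => Rabs (u n)) -> 0 <= Series (fun n => Rabs (u n)).
Proof.
intros su; apply Rle_trans with (sum_n (fun n => Rabs (u n)) 0).
- rewrite sum_O; apply Rabs_pos.
- apply sum_n_le_Series; [intros; apply Rabs_pos | exact su].
Qed.

(** Young's inequality for a summable and a bounded sequence; only the values
    up to [n] of the second one enter, which is what makes it usable inside
    an induction on [n]. *)
Lemma conv_bound (u v : nat -> R) (M : R) (n : nat) :
  ex_series (fun j => Rabs (u j)) ->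
  (forall j, (j <= n)%nat -> Rabs (v j) <= M) ->
  Rabs (conv u v n) <= Series (fun j => Rabs (u j)) * M.
Proof.
intros su vM.
assert (M0 : 0 <= M).
{ apply Rle_trans with (2 := vM 0%nat (Nat.le_0_l n)); apply Rabs_pos. }
apply Rle_trans with (sum_n (fun j => Rabs (u (n - j)%nat * v j)) n).
{ apply (norm_sum_n_m (K := R_AbsRing) (V := R_NormedModule)). }
apply Rle_trans with (sum_n (fun j => Rabs (u (n - j)%nat) * M) n).
{ rewrite !sum_n_Reals; apply sum_Rle; intros j Hj; rewrite Rabs_mult.
  apply Rmult_le_compat_l; [apply Rabs_pos | now apply vM]. }
rewrite (sum_n_mult_r (K := R_Ring) M (fun j => Rabs (u (n - j)%nat))).
apply Rmult_le_compat_r; [exact M0|].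
rewrite (sum_n_rev (fun j => Rabs (u j))).
apply sum_n_le_Series; [intros; apply Rabs_pos | exact su].
Qed.

(** * Growth estimates *)

(** The limits control [f t - t] outside a compact interval and continuity
    bounds it inside. *)
Lemma sublinear_perturbation (f : R -> R)
  (fc : forall t, continuous f t)
  (fp : is_lim (fun t => f t / t) p_infty 1)
  (fm : is_lim (fun t => f t / t) m_infty 1) (eps : R) :
  0 < eps -> exists C, 0 <= C /\ forall t, Rabs (f t - t) <= eps * Rabs t + C.
Proof.
intros eps0.
apply is_lim_spec in fp; apply is_lim_spec in fm.
destruct (fp (mkposreal eps eps0)) as [P HP].
destruct (fm (mkposreal eps eps0)) as [N HN]; simpl in HP, HN.
assert (away : forall t, t <> 0 -> Rabs (f t / t - 1) < eps ->
  Rabs (f t - t) <= eps * Rabs t).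
{ intros t t0 Ht.
  replace (f t - t) with ((f t / t - 1) * t) by (field; exact t0).
  rewrite Rabs_mult; apply Rmult_le_compat_r; [apply Rabs_pos | lra]. }
destruct (bounded_continuity (fun t => f t - t) (Rmin N (-1)) (Rmax P 1))
  as [C HC].
{ intros t _; apply (continuous_minus f (fun t => t)); [apply fc|].
  apply continuous_id. }
exists (Rmax C 0); split; [apply Rmax_r|]; intros t.
pose proof (Rmax_l C 0) as C1; pose proof (Rmax_r C 0) as C2.
pose proof (Rmax_l P 1) as P1; pose proof (Rmax_r P 1) as P2.
pose proof (Rmin_l N (-1)) as N1; pose proof (Rmin_r N (-1)) as N2.
destruct (Rlt_le_dec (Rmax P 1) t) as [tP|tP].
{ apply Rle_trans with (eps * Rabs t); [|lra].
  apply away; [lra | apply HP; lra]. }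
destruct (Rlt_le_dec t (Rmin N (-1))) as [tN|tN].
{ apply Rle_trans with (eps * Rabs t); [|lra].
  apply away; [lra | apply HN; lra]. }
specialize (HC t (conj tN tP)).
change (Rabs (f t - t) < C) in HC.
pose proof (Rmult_le_pos eps (Rabs t) (Rlt_le _ _ eps0) (Rabs_pos t)); lra.
Qed.

(** The finitely many exceptional values are absorbed in the constant, since
    the weight [b] is at least [1]. *)
Lemma bound_from_eventual_bound (h b : nat -> R) (L : R) (N : nat) :
  (forall n, 1 <= b n) ->
  (forall n, (N <= n)%nat -> Rabs (h n) <= L * b n) ->
  exists B, 0 <= B /\ forall n, Rabs (h n) <= B * b n.
Proof.
intros b1; revert L; induction N as [|N IH]; intros L HL.
- exists (Rmax L 0); split; [apply Rmax_r|]; intros n.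
  apply Rle_trans with (1 := HL n (Nat.le_0_l n)).
  apply Rmult_le_compat_r; [generalize (b1 n); lra | apply Rmax_l].
- apply (IH (Rmax L (Rabs (h N)))); intros n Hn.
  pose proof (b1 n) as bn.
  destruct (Nat.eq_dec n N) as [->|nN].
  + apply Rle_trans with (Rabs (h N) * b N).
    * rewrite -{1}(Rmult_1_r (Rabs (h N))).
      apply Rmult_le_compat_l; [apply Rabs_pos | exact bn].
    * apply Rmult_le_compat_r; [lra | apply Rmax_r].
  + apply Rle_trans with (1 := HL n ltac:(lia)).
    apply Rmult_le_compat_r; [lra | apply Rmax_l].
Qed.

(** If each [d n] is controlled by the previous values with gain [q <= 1/2],
    then the bound [2 * (E n)] reproduces itself: [q * 2 + 1 <= 2]. *)
Lemma perturbation_gain (d E : nat -> R) (q : R)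
  (q0 : 0 <= q) (q1 : q <= 1 / 2) (E0 : forall n, 0 <= E n)
  (Emono : forall m n, (m <= n)%nat -> E m <= E n)
  (step : forall n M, 0 <= M ->
    (forall j, (j < n)%nat -> Rabs (d j) <= M) -> Rabs (d n) <= q * M + E n) :
  forall n, Rabs (d n) <= 2 * E n.
Proof.
induction n as [n IH] using lt_wf_ind.
pose proof (E0 n) as En.
apply Rle_trans with (q * (2 * E n) + E n).
- apply step; [lra|]; intros j Hj.
  pose proof (Emono j n ltac:(lia)); specialize (IH j Hj); lra.
- pose proof (Rmult_le_compat_r (2 * E n) q (1 / 2) ltac:(lra) q1); lra.
Qed.

(** The equation of [d] is linear with forcing [conv k phi], so its solution
    formula bounds [d n] by the earlier values of [phi], hence by those of
    [d] and [y], with gain [Q * K * e] for a parameter [e] that can be taken small.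
    [phi] stands for the sequence of nonlinear remainders along [x]. *)
Lemma perturbation_little_o (k r phi x y d b : nat -> R) (B : R)
  (sk : ex_series (fun n => Rabs (k n))) (sr : ex_series (fun n => Rabs (r n)))
  (r0 : r 0%nat = 1) (rS : forall n, r (S n) = conv k r n)
  (d0 : d 0%nat = 0)
  (dS : forall n, d (S n) = conv k phi n + conv k d n)
  (xdy : forall n, x n = d n + y n)
  (phi_small : forall eps, 0 < eps ->
    exists C, 0 <= C /\ forall n, Rabs (phi n) <= eps * Rabs (x n) + C)
  (b0 : forall n, 0 <= b n) (bmono : forall m n, (m <= n)%nat -> b m <= b n)
  (B0 : 0 <= B) (yB : forall n, Rabs (y n) <= B * b n) (eps : R) :
  0 < eps -> exists C, forall n, Rabs (d n) <= eps * b n + C.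
Proof.
intros eps0.
set (K := Series (fun n => Rabs (k n))).
set (Q := Series (fun n => Rabs (r n))).
assert (K0 : 0 <= K) by now apply Series_Rabs_ge0.
assert (Q0 : 0 <= Q) by now apply Series_Rabs_ge0.
pose proof (Rmult_le_pos Q K Q0 K0) as QK0.
(* [e] makes the gain [Q * K * e] at most [1/2] and the final coefficient
   [2 * (Q * K * e) * B] at most [eps]. *)
set (e := Rmin 1 eps / (2 * (1 + Q * K) * (1 + B))).
assert (m0 : 0 < Rmin 1 eps) by (apply Rmin_pos; lra).
pose proof (Rmin_l 1 eps) as m1; pose proof (Rmin_r 1 eps) as m2.
assert (den : 0 < 2 * (1 + Q * K) * (1 + B)) by (apply Rmult_lt_0_compat; lra).
assert (e0 : 0 < e) by now apply Rdiv_lt_0_compat.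
assert (eE : 2 * (1 + Q * K) * (1 + B) * e = Rmin 1 eps).
{ unfold e; field; lra. }
set (q := Q * K * e).
assert (q0 : 0 <= q) by (apply Rmult_le_pos; lra).
assert (qB0 : 0 <= q * B) by now apply Rmult_le_pos.
assert (eB0 : 0 <= e * B) by (apply Rmult_le_pos; lra).
assert (eE' : 2 * (e + q + e * B + q * B) = Rmin 1 eps).
{ rewrite -eE; unfold q; ring. }
destruct (phi_small e e0) as [C [C0 HC]].
pose proof (Rmult_le_pos (Q * K) C QK0 C0) as QKC0.
exists (2 * (Q * K * C)); intros n.
apply Rle_trans with (2 * (q * B * b n + Q * K * C)).
2:{ pose proof (Rmult_le_compat_r (b n) (2 * (q * B)) eps (b0 n)
      ltac:(lra)); lra. }
apply (perturbation_gain d (fun n => q * B * b n + Q * K * C) q); try lra.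
- intros m; pose proof (Rmult_le_pos _ _ qB0 (b0 m)); lra.
- intros m p mp.
  pose proof (Rmult_le_compat_l _ _ _ qB0 (bmono m p mp)); lra.
- clear n; intros n M M0 dM.
  set (g := fun n => match n with O => 0 | S m => conv k phi m end).
  rewrite (variation_of_constants k r g d r0 rS d0 dS).
  set (P := e * (M + B * b n) + C).
  assert (P0 : 0 <= P).
  { pose proof (Rmult_le_pos B (b n) B0 (b0 n)).
    pose proof (Rmult_le_pos e (M + B * b n) ltac:(lra) ltac:(lra)).
    unfold P; lra. }
  replace (q * M + (q * B * b n + Q * K * C)) with (Q * (K * P))
    by (unfold q, P; ring).
  apply conv_bound; [exact sr|]; intros [|j] Hj; simpl.
  { rewrite Rabs_R0; now apply Rmult_le_pos. }
  apply conv_bound; [exact sk|]; intros i Hi.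
  apply Rle_trans with (1 := HC i).
  apply Rplus_le_compat_r, Rmult_le_compat_l; [lra|].
  rewrite xdy; apply Rle_trans with (1 := Rabs_triang _ _).
  apply Rplus_le_compat; [apply dM; lia|].
  apply Rle_trans with (1 := yB i), Rmult_le_compat_l; [exact B0|].
  apply bmono; lia.
Qed.

(** * Upper limits and limits of quotients *)

Lemma LimSup_lt_p_infty_bound (u : nat -> R) :
  Rbar_lt (LimSup_seq u) p_infty ->
  exists L N, forall n, (N <= n)%nat -> u n <= L.
Proof.
intros Hu; destruct (ex_LimSup_seq u) as [l Hl].
rewrite (is_LimSup_seq_unique _ _ Hl) in Hu.
destruct l as [l| |]; [| destruct Hu |].
- destruct (Hl (mkposreal 1 Rlt_0_1)) as [_ [N HN]]; simpl in HN.
  exists (l + 1), N; intros n Hn; left; now apply HN.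
- destruct (Hl 0) as [N HN].
  exists 0, N; intros n Hn; left; now apply HN.
Qed.

Lemma bound_LimSup_lt_p_infty (u : nat -> R) (L : R) (N : nat) :
  (forall n, (N <= n)%nat -> u n <= L) -> Rbar_lt (LimSup_seq u) p_infty.
Proof.
intros HL; apply Rbar_le_lt_trans with (Finite L); [|exact I].
rewrite -(LimSup_seq_const L); apply LimSup_le.
exists N; exact HL.
Qed.

Lemma is_lim_seq_div_0 (d a : nat -> R) :
  is_lim_seq a p_infty ->
  (forall eps, 0 < eps ->
    exists C, eventually (fun n => Rabs (d n) <= eps * a n + C)) ->
  is_lim_seq (fun n => d n / a n) 0.
Proof.
intros alim dsmall; apply is_lim_seq_spec; intros eps.
assert (eps0 := cond_pos eps).
destruct (dsmall (eps / 2) ltac:(lra)) as [C HC].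
apply is_lim_seq_spec in alim.
(* Beyond this threshold [C < eps / 2 * a n]. *)
assert (HA := alim (Rmax 0 (2 * C / eps))).
generalize (filter_and _ _ HC HA); apply filter_imp; intros n [Hd Ha].
pose proof (Rmax_l 0 (2 * C / eps)) as M1.
pose proof (Rmax_r 0 (2 * C / eps)) as M2.
assert (an : 0 < a n) by lra.
rewrite Rminus_0_r Rabs_div; [|lra].
rewrite (Rabs_pos_eq (a n)); [|lra].
apply Rlt_div_l; [exact an|].
assert (Hc : 2 * C / eps < a n) by lra.
apply Rlt_div_l in Hc; [lra | exact eps0].
Qed.

(** * The perturbed equation follows the linear one *)

Theorem theorem5p1
  (k r : nat -> R)
  (hk : ex_series (fun n : nat => Rabs (k n)))
  (hr0 : r 0%nat = 1)
  (hrS : forall n : nat,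
    r (S n) = sum_n (fun j : nat => k (n - j)%nat * r j) n)
  (hr : ex_series (fun n : nat => Rabs (r n)))
  (f : R -> R)
  (hfc : forall t : R, continuous f t)
  (hf_pinf : is_lim (fun t : R => f t / t) p_infty 1)
  (hf_minf : is_lim (fun t : R => f t / t) m_infty 1)
  (H : nat -> R) (xi : R) (x y : nat -> R)
  (hx0 : x 0%nat = xi)
  (hxS : forall n : nat,
    x (S n) = H (S n) + sum_n (fun j : nat => k (n - j)%nat * f (x j)) n)
  (hy0 : y 0%nat = xi)
  (hyS : forall n : nat,
    y (S n) = H (S n) + sum_n (fun j : nat => k (n - j)%nat * y j) n)
  (a : nat -> R)
  (ha_incr : Un_growing a)
  (ha_lim : is_lim_seq a p_infty)
  (hH : Rbar_lt (LimSup_seq (fun n : nat => Rabs (H n) / a n)) p_infty) :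
  Rbar_lt (LimSup_seq (fun n : nat => Rabs (y n) / a n)) p_infty /\
  is_lim_seq (fun n : nat => (x n - y n) / a n) 0.
Proof.
set (b := fun n => Rmax 1 (a n)).
assert (b1 : forall n, 1 <= b n) by (intros; apply Rmax_l).
assert (bmono : forall m n, (m <= n)%nat -> b m <= b n).
{ intros m n mn; apply Rle_max_compat_l.
  apply Rge_le, (growing_prop a n m ha_incr); lia. }
assert (ab : exists N, forall n, (N <= n)%nat -> 0 < a n /\ b n = a n).
{ pose proof (proj2 (is_lim_seq_spec _ _) ha_lim 1) as [N HN].
  exists N; intros n Hn; specialize (HN n Hn).
  split; [lra | apply Rmax_right; lra]. }
destruct ab as [Na HNa].
destruct (LimSup_lt_p_infty_bound _ hH) as [L [NL HL]].
(* The forcing term of the equation of [y]: the initial value takes the place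
   of [H 0]. *)
set (h := fun n => match n with O => xi | S _ => H n end).
assert (hB : exists B, 0 <= B /\ forall n, Rabs (h n) <= B * b n).
{ apply (bound_from_eventual_bound h b L (S (Na + NL)) b1).
  intros [|n] Hn; [lia|]; simpl.
  destruct (HNa (S n) ltac:(lia)) as [an ->].
  apply Rle_div_l; [exact an|]; apply HL; lia. }
destruct hB as [B [B0 hB]].
set (Q := Series (fun n => Rabs (r n))).
assert (yB : forall n, Rabs (y n) <= Q * B * b n).
{ intros n; rewrite (variation_of_constants k r h y hr0 hrS hy0 hyS).
  rewrite Rmult_assoc; apply conv_bound; [exact hr|]; intros j Hj.
  apply Rle_trans with (1 := hB j), Rmult_le_compat_l; [exact B0|].
  now apply bmono. }
split.
- apply (bound_LimSup_lt_p_infty _ (Q * B) Na); intros n Hn.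
  destruct (HNa n Hn) as [an bn].
  apply Rle_div_l; [exact an|]; rewrite -bn; apply yB.
- apply is_lim_seq_div_0; [exact ha_lim|]; intros eps eps0.
  destruct (perturbation_little_o k r (fun n => f (x n) - x n) x y
    (fun n => x n - y n) b (Q * B)) with (eps := eps) as [C HC]; try assumption.
  + rewrite hx0 hy0; ring.
  + intros n; rewrite hxS hyS; unfold conv.
    rewrite (sum_n_ext (fun j => k (n - j)%nat * f (x j)) (fun j => plus
      (plus (k (n - j)%nat * (f (x j) - x j)) (k (n - j)%nat * (x j - y j)))
      (k (n - j)%nat * y j))).
    2:{ intros j; unfold plus; simpl; ring. }
    rewrite !sum_n_plus; unfold plus; simpl; ring.
  + intros n; ring.
  + intros e e0.
    destruct (sublinear_perturbation f hfc hf_pinf hf_minf e e0)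
      as [C [C0 HC]].
    exists C; split; [exact C0 | intros n; apply HC].
  + intros n; generalize (b1 n); lra.
  + apply Rmult_le_pos; [now apply Series_Rabs_ge0 | exact B0].
  + exists C, Na; intros n Hn.
    destruct (HNa n Hn) as [_ <-]; apply HC.
Qed.
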